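(* There exists a deterministic distributed algorithm in the CONGEST model that, on any $n$-node graph $G$, computes a $2$-ruling edge set of $G$ in $O(\log^* n)$ rounds; moreover this is asymptotically optimal, i.e. the round complexity is $\Theta(\log^* n)$.
   Context: CONGEST model: the network is an $n$-node graph $G=(V,E)$; each node has a unique $O(\log n)$-bit ID; computation proceeds in synchronous rounds, in each of which every node may send a message of $O(\log n)$ bits to each neighbor and perform unbounded local computation; the running time is the number of rounds. The distance $\mathrm{dist}(e,f)$ between two edges $e,f$ of $G$ is the distance between the corresponding nodes in the line graph of $G$. An $(\alpha,\beta)$-ruling edge set of $G$ is a set $R\subseteq E$ such that any two distinct edges of $R$ are at distance at least $\alpha$, and for every edge $e\in E$ there is $f\in R$ with $\mathrm{dist}(e,f)\leq\beta$. A $\beta$-ruling edge set means a $(2,\beta)$-ruling edge set. *)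

(* Defs.v *)
From mathcomp Require Import all_boot.

Set Implicit Arguments.
Unset Strict Implicit.
Unset Printing Implicit Defensive.

Lemma logstar_exists (n : nat) : exists k, iter k (up_log 2) n <= 1.
Proof.
elim/ltn_ind: n => n IHn.
have [le_n1 | lt_1n] := leqP n 1; first by exists 0.
have lt_log : up_log 2 n < n.
  rewrite -{2}(prednK (ltnW lt_1n)) ltnS; apply: up_log_min => //.
  by rewrite -{1}(prednK (ltnW lt_1n)); exact: ltn_expl.
by have [k le_k1] := IHn _ lt_log; exists k.+1; rewrite iterSr.
Qed.

(* [up_log 2] is the ceiling of log2.  Rounding up after every step does not
   change the number of iterations needed to reach a value at most 1. *)
Definition logstar (n : nat) : nat := ex_minn (logstar_exists n).

Definition bigO (f g : nat -> nat) : Prop :=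
  exists C n0, forall n, n0 <= n -> f n <= C * g n.

Definition walk (T : eqType) (r : rel T) (x : T) (k : nat) (y : T) : Prop :=
  exists p : seq T, [/\ path r x p, last x p = y & size p = k].

(* The distance is the least length of a walk, and is infinite when there is
   no walk; the next two predicates bound it without naming its value. *)
Definition dist_le (T : eqType) (r : rel T) (x y : T) (k : nat) : Prop :=
  exists2 j, j <= k & walk r x j y.

Definition dist_ge (T : eqType) (r : rel T) (x y : T) (k : nat) : Prop :=
  forall j, walk r x j y -> k <= j.

Record graph (n : nat) := Graph {
  adj :> rel 'I_n;
  adj_sym : symmetric adj;
  adj_irrefl : irreflexive adj
}.

Definition edges (n : nat) (G : graph n) : {set {set 'I_n}} :=
  [set e | [exists u, exists v, G u v && (e == [set u; v])]].

Definition line_adj (n : nat) (G : graph n) : rel {set 'I_n} :=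
  fun e f => [&& e \in edges G, f \in edges G, e != f & e :&: f != set0].

Definition ruling_edge_set (n : nat) (G : graph n) (alpha beta : nat)
    (R : {set {set 'I_n}}) : Prop :=
  [/\ R \subset edges G,
      forall e f, e \in R -> f \in R -> e != f ->
        dist_ge (line_adj G) e f alpha
    & forall e, e \in edges G ->
        exists2 f, f \in R & dist_le (line_adj G) e f beta].

(* The code run by every node.  Neighbours are addressed through ports, numbered
   from 0 to degree - 1.  Initially a node knows its own identifier and its
   degree only; in particular it is not told the number n of nodes.
   - [send s i] is the message sent through port i; [::] means no message.
   - [recv s ms] is the new state, [nth [::] ms i] being the message received
     through port i.
   - [out s = None] means that the node is still running; [out s = Some o] that
     it has terminated, [o i] telling whether the edge at port i is chosen. *)
Record algorithm := Algorithm {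
  state : Type;
  init : nat -> nat -> state;
  send : state -> nat -> seq bool;
  recv : state -> seq (seq bool) -> state;
  out : state -> option (pred nat)
}.

(* Identifiers of at most [a * ceil(log2 n)] bits. *)
Definition valid_ids (a n : nat) (id : 'I_n -> nat) : Prop :=
  injective id /\ forall v, id v < 2 ^ (a * up_log 2 n).

(* [ports v] lists the neighbours of v in the order of the ports of v. *)
Definition valid_ports (n : nat) (G : graph n) (ports : 'I_n -> seq 'I_n) :
    Prop :=
  forall v, uniq (ports v) /\ forall u, (u \in ports v) = G v u.

Section Execution.

Variables (A : algorithm) (n : nat).
Variables (id : 'I_n -> nat) (ports : 'I_n -> seq 'I_n).

Definition initial (v : 'I_n) : state A := init A (id v) (size (ports v)).

(* A terminated node stays silent and keeps its state for ever. *)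
Definition message (s : 'I_n -> state A) (u v : 'I_n) : seq bool :=
  if out (s u) is Some _ then [::] else send (s u) (index v (ports u)).

Definition round (s : 'I_n -> state A) (v : 'I_n) : state A :=
  if out (s v) is Some _ then s v
  else recv (s v) [seq message s u v | u <- ports v].

Definition run (t : nat) : 'I_n -> state A := iter t round initial.

(* Both endpoints of an edge must agree on whether it belongs to R. *)
Definition outputs_edge_set (t : nat) (R : {set {set 'I_n}}) : Prop :=
  forall v, exists2 o : pred nat, out (run t v) = Some o
    & forall u, u \in ports v -> o (index u (ports v)) = ([set v; u] \in R).

End Execution.

(* On every n-node graph, with identifiers of at most [a * ceil(log2 n)] bits
   and messages of at most [b * ceil(log2 n)] bits, all nodes have terminated
   after t rounds and the output is a beta-ruling edge set. *)
Definition computes_ruling_edge_set (beta a b : nat) (A : algorithm)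
    (n t : nat) : Prop :=
  forall (G : graph n) (id : 'I_n -> nat) (ports : 'I_n -> seq 'I_n),
    valid_ids a id -> valid_ports G ports ->
    (forall i u v, G u v ->
       size (message ports (run A id ports i) u v) <= b * up_log 2 n) /\
    (exists2 R, ruling_edge_set G 2 beta R & outputs_edge_set A id ports t R).

(* Main.v *)
(* Upper bound.  Every node v with a neighbour of at most its own level picks one
   such neighbour as its parent; of two adjacent nodes at least one has a parent.
   It is enough to find a matching that covers v or its parent, for every v with
   a parent.  The level is the number of Cole-Vishkin steps that an identifier
   needs to shrink below 6, at most log* n + O(1); nodes of the same level are
   coloured with 6 colours against their parents, and then every node proposes to
   its parent in the round given by its level and its colour.  Levels replace the
   knowledge of n: a node can stop as soon as all of its neighbours have had
   their turn.

   Lower bound (Linial).  On a path, the output of a node after t rounds is a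
   function of the 2 t + 1 identifiers around it.  The number of steps to the next
   chosen edge is then a proper 6-colouring of the windows of 2 t + 6 increasing
   identifiers below n.  Replacing a colour by the set of colours reachable by
   changing the last identifier shortens the windows by one; with windows of
   length 1 the colouring is injective, so n is at most a tower of height 2 t + 5. *)

Require Import Defs.
From mathcomp Require Import all_boot zify.

Set Implicit Arguments.
Unset Strict Implicit.
Unset Printing Implicit Defensive.

(** * Iterated logarithm *)

Lemma logstar_le n k : (logstar n <= k) = (iter k (up_log 2) n <= 1).
Proof.
rewrite /logstar; case: ex_minnP => m le_m1 min_m.
apply/idP/idP => [le_mk|]; last exact: min_m.
rewrite -(subnK le_mk) iterD; elim: (k - m) => //= j IHj.
by rewrite (leq_trans (leq_up_log _ IHj)).
Qed.

Lemma logstar_up_log n k : (logstar n <= k.+1) = (logstar (up_log 2 n) <= k).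
Proof. by rewrite !logstar_le iterSr. Qed.

Lemma leq_logstar m n : m <= n -> logstar m <= logstar n.
Proof.
move=> le_mn; rewrite logstar_le.
have: iter (logstar n) (up_log 2) n <= 1 by rewrite -logstar_le.
apply: leq_trans.
by elim: (logstar n) => //= k IHk; apply: leq_up_log.
Qed.

Lemma logstar_exp m : logstar (2 ^ m) <= (logstar m).+1.
Proof. by rewrite logstar_up_log up_expnK. Qed.

Lemma logstar_leq n : logstar n <= n.
Proof.
elim/ltn_ind: n => n IHn; rewrite logstar_le.
case: n IHn => [|[|n]] // IHn; rewrite -logstar_le logstar_up_log.
have lt_log : up_log 2 n.+2 < n.+2 by rewrite ltnS up_log_min // ltn_expl.
exact: leq_trans (IHn _ lt_log) _.
Qed.

(** * Lower bound *)

(** The exponential hits the argument first, so that one unfolding matches the passage from colours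
    in [C] to colours in [{set C}]. *)
Fixpoint tower k q := if k is k'.+1 then tower k' (2 ^ q) else q.

Lemma logstar_tower k q : logstar (tower k q) <= k + logstar q.
Proof.
elim: k q => //= k IHk q; apply: leq_trans (IHk _) _.
by rewrite addSnnS leq_add2l logstar_exp.
Qed.

Lemma logstar_unbounded m : exists n0, forall n, n0 <= n -> m < logstar n.
Proof.
elim: m => [|m [n0 IHm]].
  exists 2 => n; case: n => [|[|n]] // _.
  by rewrite ltnNge logstar_le.
exists (2 ^ n0).+1 => n lt_n; rewrite ltnNge logstar_up_log -ltnNge.
apply: IHm; rewrite -(@leq_exp2l 2) // ltnW //.
exact: leq_trans lt_n (up_logP _ _).
Qed.

Lemma window_coloring_bound n k (C : finType) (f : seq nat -> C) :
  (forall s, size s = k.+2 -> sorted ltn s -> all (gtn n) s ->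
     f (take k.+1 s) != f (behead s)) ->
  n <= tower k #|C|.
Proof.
elim: k C f => [|k IHk] C f f_proper /=.
  have f_inj : injective (fun i : 'I_n => f [:: val i]).
    move=> i j; have [lt_ij|lt_ji|/val_inj//] := ltngtP i j => eq_f.
      have := f_proper [:: val i; val j] erefl.
      by rewrite /= lt_ij !ltn_ord /= eq_f eqxx => /(_ isT isT).
    have := f_proper [:: val j; val i] erefl.
    by rewrite /= lt_ji !ltn_ord /= eq_f eqxx => /(_ isT isT).
  by have := leq_card _ f_inj; rewrite card_ord.
pose g s := [set f (rcons s (val y)) | y : 'I_n & sorted ltn (rcons s (val y))].
have -> : 2 ^ #|C| = #|{set C}|.
  by rewrite -[RHS]cardsT -powersetT card_powerset cardsT.
apply: (IHk _ g) => s sz_s srt_s lt_s; apply: contraT; rewrite negbK => /eqP eq_g.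
case/lastP: s sz_s srt_s lt_s eq_g => // s z; rewrite size_rcons => -[sz_s] srt_s.
rewrite all_rcons => /andP[/= lt_z lt_s]; rewrite -cats1 takel_cat ?sz_s //.
rewrite take_oversize ?sz_s // cats1.
(* Equal values of [g] give this colour also to an increasing window [rcons (behead (rcons s z)) y],
   which [f] must separate from [rcons s z]. *)
have : f (rcons s z) \in g s by apply/imsetP; exists (Ordinal lt_z); rewrite ?inE.
move=> fs eq_g; move: fs; rewrite eq_g => /imsetP[y]; rewrite inE => srt_y eq_f.
have := f_proper (rcons (rcons s z) (val y)).
rewrite !size_rcons sz_s => /(_ erefl).
have -> : sorted ltn (rcons (rcons s z) (val y)).
  case: s sz_s srt_s srt_y {lt_s eq_g eq_f} => //= x s _ srt_z.
  rewrite rcons_path srt_z last_rcons; case: s {srt_z} => [|x' s] /=.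
    by rewrite andbT.
  by rewrite (rcons_path _ _ (rcons s z)) last_rcons => /andP[].
rewrite !all_rcons /= ltn_ord lt_z lt_s => /(_ isT isT).
rewrite -[in take _ _]cats1 takel_cat ?size_rcons ?sz_s //.
rewrite take_oversize ?size_rcons ?sz_s // eq_f.
by case: s sz_s {srt_s lt_s srt_y eq_g eq_f} => //= x s _; rewrite eqxx.
Qed.

(** * Executions on a path *)

Definition emit (A : algorithm) (s : state A) i :=
  if out s is Some _ then [::] else send s i.

(* The state after t rounds of the node i + t of a path whose nodes carry the
   identifiers x 0, x 1, ... and have port 0 towards the next node; it depends
   on x i, ..., x (i + 2 * t) only. *)
Fixpoint view (A : algorithm) (x : nat -> nat) t i : state A :=
  if t is t'.+1 then
    let s := view A x t' i.+1 in
    if out s is Some _ then s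
    else recv s [:: emit (view A x t' i.+2) 1; emit (view A x t' i) 0]
  else init A (x i) 2.

Lemma eq_view A x y t i :
  (forall j, i <= j <= i + t.*2 -> x j = y j) -> view A x t i = view A y t i.
Proof.
elim: t i => [|t IHt] i eq_xy /=; first by rewrite eq_xy // addn0 leqnn.
by rewrite !IHt // => j le_j; apply: eq_xy; lia.
Qed.

Lemma view_shift A x t i : view A (x \o S) t i = view A x t i.+1.
Proof. by elim: t i => //= t IHt i; rewrite !IHt. Qed.

Section PathGraph.

Variable n : nat.

Definition path_adj : rel 'I_n := fun u v => (u.+1 == v) || (v.+1 == u).

Lemma path_adj_sym : symmetric path_adj.
Proof. by move=> u v; rewrite /path_adj orbC. Qed.

Lemma path_adj_irrefl : irreflexive path_adj.
Proof. by move=> u; rewrite /path_adj; lia. Qed.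

Definition path_graph := Graph path_adj_sym path_adj_irrefl.

Definition path_ports (v : 'I_n) : seq 'I_n :=
  [seq u : 'I_n <- enum 'I_n | v.+1 == u] ++ [seq u : 'I_n <- enum 'I_n | u.+1 == v].

Lemma path_ports_valid : valid_ports path_graph path_ports.
Proof.
move=> v; split=> [|u]; last first.
  by rewrite mem_cat !mem_filter -!enumT !mem_enum !inE !andbT.
rewrite cat_uniq !filter_uniq -?enumT ?enum_uniq //= andbT.
by apply/hasPn => u; rewrite !mem_filter -!enumT !mem_enum; lia.
Qed.

Lemma path_ports_interior (u v w : 'I_n) :
  u.+1 = v -> v.+1 = w -> path_ports v = [:: w; u].
Proof.
move=> uv vw; rewrite /path_ports.
rewrite (eq_filter (a2 := pred1 w)) => [|z /=]; last first.
  by rewrite vw -val_eqE eq_sym.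
rewrite [X in _ ++ X](eq_filter (a2 := pred1 u)) => [|z /=]; last first.
  by rewrite -uv -val_eqE eqSS.
by rewrite !filter_pred1_uniq -?enumT ?enum_uniq ?mem_enum.
Qed.

(** The bounds keep the nodes [i], ..., [i + t.*2] off both ends of the path, so that all of them
    have degree 2 and the ports assumed in [view]. *)
Lemma run_view A x t i (v : 'I_n) : 0 < i -> i + t.*2.+1 < n -> v = i + t :> nat ->
  run A (x \o val) path_ports t v = view A x t i.
Proof.
elim: t i v => [|t IHt] i v i_gt0 lt_n eq_v.
  have lt_u : v.-1 < n by lia.
  have lt_w : v.+1 < n by lia.
  rewrite /= /initial (@path_ports_interior (Ordinal lt_u) v (Ordinal lt_w)) //=.
    by rewrite eq_v addn0.
  by lia.
have lt_u' : v.-2 < n by lia.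
have lt_u : v.-1 < n by lia.
have lt_w : v.+1 < n by lia.
have lt_w' : v.+2 < n by lia.
pose u := Ordinal lt_u; pose w := Ordinal lt_w.
have ports_u : path_ports u = [:: v; Ordinal lt_u'].
  by apply: path_ports_interior => /=; lia.
have ports_w : path_ports w = [:: Ordinal lt_w'; v] by apply: path_ports_interior.
have ports_v : path_ports v = [:: w; u] by apply: path_ports_interior => /=; lia.
have neq_w : Ordinal lt_w' != v by rewrite -val_eqE /=; lia.
rewrite /run iterS -/(run _ _ _ _) {1}/round (IHt i.+1) //; try lia.
rewrite [RHS]/= ports_v /message /= (IHt i u) ?(IHt i.+2 w) //=; try lia.
by rewrite ports_u ports_w /= eqxx (negPf neq_w).
Qed.

Lemma path_edgeP (f : {set 'I_n}) : f \in edges path_graph ->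
  exists u v : 'I_n, u.+1 = v /\ f = [set u; v].
Proof.
rewrite inE => /existsP[u /existsP[v /andP[/orP[]/eqP uv /eqP ->]]].
  by exists u, v.
by exists v, u; rewrite setUC.
Qed.

Lemma path_edge (u v : 'I_n) : u.+1 = v -> [set u; v] \in edges path_graph.
Proof.
move=> uv; rewrite inE; apply/existsP; exists u; apply/existsP; exists v.
by rewrite eqxx andbT /= /path_adj uv eqxx.
Qed.

Lemma path_line_adj (u v : 'I_n) f : u.+1 = v ->
  line_adj path_graph [set u; v] f ->
  exists u' v' : 'I_n, [/\ u'.+1 = v', f = [set u'; v'], u' <= u.+1 & u <= u'.+1].
Proof.
move=> uv /and4P[_ /path_edgeP[u' [v' [uv' ->]]] _ /set0Pn[x]].
rewrite !inE -!val_eqE /= => meet; exists u', v'; split=> //; lia.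
Qed.

Lemma path_line_adj_next (u v w : 'I_n) : u.+1 = v -> v.+1 = w ->
  line_adj path_graph [set u; v] [set v; w].
Proof.
move=> uv vw; apply/and4P; split; rewrite ?path_edge //.
  apply/eqP => /setP/(_ u); rewrite !inE eqxx -!val_eqE /=; lia.
by apply/set0Pn; exists v; rewrite !inE eqxx orbT.
Qed.

End PathGraph.

Lemma path_lower_bound a b A n t : 0 < a ->
  computes_ruling_edge_set 2 a b A n t -> t.*2 + 8 <= n ->
  n <= tower (t.*2 + 5) 6.
Proof.
move=> a_gt0 computes le_n; rewrite -[6]card_ord.
(* This is the decision on the forward edge of node [i + t]. Offsets start at 1, as the view at 0
   would contain an end of the path. *)
pose bit s i := if out (view A (nth 0 s) t i) is Some o then o 0 else false.
pose f s : 'I_6 := inord (find id [seq bit s i | i <- iota 1 5]).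
apply: (@window_coloring_bound _ _ _ f) => s sz_s srt_s /allP/= lt_s.
pose w := s ++ [seq j <- iota 0 n | j \notin s].
have mem_w : w =i iota 0 n.
  move=> j; rewrite mem_cat mem_filter mem_iota add0n /=.
  by have [/lt_s|] := boolP (j \in s).
have uniq_w : uniq w.
  rewrite cat_uniq (sorted_uniq ltn_trans ltnn) // filter_uniq ?iota_uniq //.
  by rewrite andbT; apply/hasPn => j; rewrite mem_filter => /andP[].
have sz_w : size w = n.
  by rewrite -[RHS](size_iota 0); apply/perm_size/uniq_perm; rewrite ?iota_uniq.
pose ident v := (nth 0 w \o @nat_of_ord n) v.
have valid_id : valid_ids a ident.
  split=> [u v /eqP|v]; first by rewrite /ident /= nth_uniq ?sz_w // => /eqP/val_inj.
  have : ident v \in w by rewrite mem_nth ?sz_w.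
  rewrite mem_w mem_iota /= add0n => lt_v; apply: leq_trans lt_v _.
  apply: leq_trans (up_logP n (isT : 1 < 2)) _.
  by rewrite leq_exp2l // leq_pmull.
have [_ [R [subR farR domR] outR]] := computes _ _ _ valid_id (@path_ports_valid n).
have n_gt0 : 0 < n by lia.
pose node := insubd (Ordinal n_gt0).
have nodeE j : j < n -> node j = j :> nat by move=> lt_j; rewrite val_insubd lt_j.
pose e i := [set node (i + t); node (i + t).+1].
have bitE i : 0 < i <= 6 -> bit s i = (e i \in R).
  move=> le_i; have [o] := outR (node (i + t)).
  rewrite (@run_view _ _ (nth 0 w) t i) ?nodeE; try lia.
  rewrite (@eq_view _ _ (nth 0 s)) => [|j le_j]; last first.
    by rewrite nth_cat sz_s ifT //; lia.
  rewrite /bit => ->.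
  rewrite (@path_ports_interior _ (node (i + t).-1) _ (node (i + t).+1)); last 2 first.
  - by rewrite !nodeE; lia.
  - by rewrite !nodeE; lia.
  by move/(_ (node (i + t).+1)) <-; rewrite /= ?eqxx ?inE ?eqxx.
have not_both i : 0 < i <= 5 -> bit s i && bit s i.+1 = false.
  move=> le_i; apply/negP => /andP[]; rewrite !bitE ?(andP le_i) //; try lia.
  move=> Ri Ri1; have adj_ii1 : line_adj (path_graph n) (e i) (e i.+1).
    by apply: path_line_adj_next; rewrite !nodeE; lia.
  have /and4P[_ _ neq_e _] := adj_ii1.
  have /(_ 1) := farR _ _ Ri Ri1 neq_e.
  suff walk1 : walk (line_adj (path_graph n)) (e i) 1 (e i.+1) by move/(_ walk1).
  by exists [:: e i.+1]; rewrite /= adj_ii1.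
(* A chosen edge lies within distance 2 of [e 3], and each step in the line graph shifts the edge by
   at most one place. *)
have some : [|| bit s 1, bit s 2, bit s 3, bit s 4 | bit s 5].
  have lt4 : (3 + t).+1 < n by lia.
  have node3 := nodeE _ (ltnW lt4).
  have e3 : (node (3 + t)).+1 = node (3 + t).+1 by rewrite node3 nodeE.
  have [g Rg [j le_j [p [path_p last_p sz_p]]]] := domR _ (path_edge e3).
  have [u [v [uv g_uv le_u]]] : exists u v : 'I_n,
      [/\ u.+1 = v, g = [set u; v] & t < u <= t + 5].
    case: p path_p last_p sz_p => [_ <- _|g1 [|g2 [|? ?]]] /=.
    - by exists (node (3 + t)), (node (3 + t).+1); split=> //; lia.
    - rewrite andbT => /(path_line_adj e3)[u [v [uv -> ? ?]]] <- _.
      by exists u, v; split=> //; lia.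
    - rewrite andbT => /andP[/(path_line_adj e3)[u [v [uv -> ? ?]]]].
      move=> /(path_line_adj uv)[u' [v' [uv' -> ? ?]]] <- _.
      by exists u', v'; split=> //; lia.
    - lia.
  have bit_u : bit s (u - t).
    rewrite bitE; last lia.
    suff -> : e (u - t) = g by [].
    rewrite g_uv /e subnK; last lia.
    have -> : node u = u by apply: val_inj; rewrite /= nodeE.
    by have -> : node u.+1 = v by apply: val_inj; rewrite /= nodeE ?uv.
  have : u - t \in [:: 1; 2; 3; 4; 5] by rewrite !inE; lia.
  by rewrite !inE => /or4P[| | |/orP[]] /eqP eq_ut; move: bit_u; rewrite eq_ut => ->;
     rewrite ?orbT.
have bit_take i : 0 < i <= 5 -> bit (take (t.*2 + 5).+1 s) i = bit s i.
  move=> le_i; rewrite /bit (@eq_view _ _ (nth 0 s)) // => j le_j.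
  by rewrite nth_take //; lia.
have bit_behead i : bit (behead s) i = bit s i.+1.
  rewrite /bit -view_shift (@eq_view _ _ (nth 0 s \o S)) // => j _ /=.
  by rewrite nth_behead.
(* Shifting the window lowers a positive number of steps by one; from 0 it becomes positive, since
   two consecutive edges are never both chosen. *)
apply/eqP => /(congr1 val) /=.
rewrite !inordK ?ltnS ?(leq_trans (find_size _ _)) ?size_map //=.
rewrite !bit_take // !bit_behead.
move: some (not_both 1 isT) (not_both 2 isT) (not_both 3 isT) (not_both 4 isT)
  (not_both 5 isT).
by case: (bit s 1); case: (bit s 2); case: (bit s 3); case: (bit s 4);
   case: (bit s 5); case: (bit s 6).
Qed.

Lemma ruling_edge_set_lower_bound a b (A : nat -> algorithm) (T : nat -> nat) :
  0 < a -> (forall n, computes_ruling_edge_set 2 a b (A n) n (T n)) ->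
  bigO logstar T.
Proof.
(* [c] covers both the additive term of the tower bound and the case of [n] below [(T n).*2 + 8].
   Once [logstar n] exceeds [c], [T n] is positive and the factor [2 + c] absorbs it. *)
move=> a_gt0 computes; pose c := 8 + logstar 6.
have [n0 n0P] := logstar_unbounded c; exists (2 + c), n0 => n /n0P lt_n.
have le_n : logstar n <= (T n).*2 + c.
  have [le_8|lt_8] := leqP ((T n).*2 + 8) n.
    apply: leq_trans (leq_logstar (path_lower_bound a_gt0 (computes n) le_8)) _.
    by apply: leq_trans (logstar_tower _ _) _; rewrite /c; lia.
  by apply: leq_trans (logstar_leq n) _; rewrite /c; lia.
have T_gt0 : 0 < T n by lia.
rewrite mulnDl mul2n; apply: leq_trans le_n _.
by rewrite leq_add2l leq_pmulr.
Qed.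

(** * Upper bound *)

Fixpoint binary k x : seq bool :=
  if k is k'.+1 then if x == 0 then [::] else odd x :: binary k' x./2 else [::].

Definition unbinary (s : seq bool) : nat :=
  foldr (fun b x => nat_of_bool b + x.*2) 0 s.

Lemma binaryK k x : x <= k -> unbinary (binary k x) = x.
Proof.
elim: k x => [|k IHk] [|x] //= le_x; rewrite IHk ?odd_double_half //.
by rewrite -[~~ odd x]/(odd x.+1) odd_double_half.
by lia.
Qed.

Lemma size_binary k x K : x < 2 ^ K -> size (binary k x) <= K.
Proof.
elim: k x K => [|k IHk] x K //=; case: (eqVneq x) => //= x0 lt_x.
case: K lt_x => [|K]; first by rewrite expn0; lia.
by rewrite expnS ltnS => lt_x; apply: IHk; lia.
Qed.

(* One Cole-Vishkin step: 2 i + (bit i of x), for the least i at which the bits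
   of x and y differ; k bounds the number of bits examined. *)
Fixpoint cole_vishkin k x y : nat :=
  if k is k'.+1 then
    if odd x != odd y then nat_of_bool (odd x) else (cole_vishkin k' x./2 y./2).+2
  else 0.

Lemma cole_vishkin_lt k x y K : x < 2 ^ K -> y < 2 ^ K -> x != y ->
  cole_vishkin k x y < K.*2.
Proof.
elim: k x y K => [|k IHk] x y [|K]; rewrite ?expn0 //=; try lia.
rewrite !expnS => lt_x lt_y neq_xy; case: (eqVneq (odd x)) => /= [eq_odd|_]; last lia.
have := IHk x./2 y./2 K; lia.
Qed.

(** Equal results would share the index and the bit, so [x] and [y] would agree at the very index
    where they differ. *)
Lemma cole_vishkin_neq k l x y z : x < 2 ^ k -> y < 2 ^ k -> y < 2 ^ l ->
  z < 2 ^ l -> x != y -> y != z -> cole_vishkin k x y != cole_vishkin l y z.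
Proof.
elim: k l x y z => [|k IHk] [|l] x y z; rewrite ?expn0 ?expnS //=; try lia.
move=> lt_x lt_y lt_y' lt_z neq_xy neq_yz.
case: (eqVneq (odd x)) => /= eq_xy; case: (eqVneq (odd y)) => /= eq_yz; try lia.
have := IHk l x./2 y./2 z./2; lia.
Qed.

(** A node without a parent on its level moves to [odd y], as if its parent differed in bit 0. Its
    child gets the opposite bit at index 0, or a value of at least 2. *)
Lemma cole_vishkin_neq_odd k x y : x < 2 ^ k -> y < 2 ^ k -> x != y ->
  cole_vishkin k x y != odd y.
Proof.
case: k => [|k] /=; rewrite ?expn0 => lt_x lt_y neq_xy; first lia.
by case: (eqVneq (odd x)) => /= eq_xy; lia.
Qed.

(* D Cole-Vishkin steps bring colours below [color_bound D] down below 6. *)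
Fixpoint color_bound D := if D is D'.+1 then 2 ^ (color_bound D')./2 else 6.

Lemma color_bound_ge D : D + 6 <= color_bound D.
Proof.
have exp_ge k : 2 < k -> k.*2.+2 <= 2 ^ k.
  by elim: k => // -[|[|[|k]]] // IHk _; rewrite expnS; have := IHk isT; lia.
elim: D => //= D IHD; have := exp_ge (color_bound D)./2; lia.
Qed.

Lemma level_exists x : exists D, x < color_bound D.
Proof. by exists x; have := color_bound_ge x; lia. Qed.

Definition level x := ex_minn (level_exists x).

Lemma level_le x D : x < color_bound D -> level x <= D.
Proof. by rewrite /level; case: ex_minnP => m _; apply. Qed.

Lemma ltn_color_bound_level x : x < color_bound (level x).
Proof. by rewrite /level; case: ex_minnP. Qed.

Lemma leq_color_bound : {homo color_bound : D E / D <= E}.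
Proof.
apply: homo_leq => // [? ? ?|D]; first exact: leq_trans.
elim: D => // D IHD; rewrite [X in _ <= X]/= leq_exp2l //.
exact: half_leq.
Qed.

Lemma dist_le_trans (T : eqType) (r : rel T) x y z k l :
  dist_le r x y k -> dist_le r y z l -> dist_le r x z (k + l).
Proof.
move=> [i le_ik [p [path_p last_p sz_p]]] [j le_jl [q [path_q last_q sz_q]]].
exists (i + j); first exact: leq_add.
exists (p ++ q); split; first by rewrite cat_path path_p last_p.
  by rewrite last_cat last_p.
by rewrite size_cat sz_p sz_q.
Qed.

(* The unmatched nodes and the nodes without a parent use the degree, which is
   not a port, as value of [mate_port] and [parent_port]. *)
Record node := Node {
  clock : nat;
  ident : nat;
  degree : nat;
  parent_port : nat;
  same_level : bool;
  top_level : nat;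
  color : nat;
  mate_port : nat
}.

Definition node_init x d := Node 0 x d d false (level x) x d.

(** Level [l] owns a block of twelve rounds ending at [last_round l]: for each of six colours, an
    odd round to propose and an even one to acknowledge. Its colours are final before the block
    starts. *)
Definition propose_time l c := 12 * l.+1 + 2 * c + 1.

(** A matched node repeats its flag every round, which serves as acknowledgement. At clock 0 the
    colour is still the identifier. *)
Definition node_send s i : seq bool :=
  let proposes := (clock s == propose_time (level (ident s)) (color s)) &&
    (degree s <= mate_port s) in
  ((mate_port s == i) || proposes && (parent_port s == i))
    :: binary (color s) (color s).

(** A failing [find] returns the degree, the value for a missing parent or mate; the default [l.+1]
    then makes [same_level] false. *)
Definition node_recv s (ms : seq (seq bool)) : node :=
  let l := level (ident s) in
  let colors := [seq unbinary (behead m) | m <- ms] in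
  if clock s == 0 then
    let levels := [seq level x | x <- colors] in
    let p := find (leq^~ l) levels in
    Node 1 (ident s) (degree s) p (nth l.+1 levels p == l) (foldr maxn l levels)
      (color s) (mate_port s)
  else
    let c := nth 0 colors (parent_port s) in
    Node (clock s).+1 (ident s) (degree s) (parent_port s) (same_level s)
      (top_level s)
      (if clock s <= l then
         if same_level s then cole_vishkin (color s + c) (color s) c
         else odd (color s)
       else color s)
      (if mate_port s < degree s then mate_port s else find (head false) ms).

Definition last_round l := 12 * l.+2.

Definition node_out s : option (pred nat) :=
  if clock s <= last_round (top_level s) then None
  else Some (fun i => i == mate_port s).

Definition matching_algorithm := Algorithm node_init node_send node_recv node_out.

(** * Executions of the matching algorithm *)

Section MatchingRun.

Variables (n : nat) (G : graph n) (id : 'I_n -> nat) (ports : 'I_n -> seq 'I_n).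
Hypothesis id_inj : injective id.
Hypothesis portsP : valid_ports G ports.

Local Notation st := (run matching_algorithm id ports).

Definition lev v := level (id v).
Definition deg v := size (ports v).
Definition pport v := find (fun u => lev u <= lev v) (ports v).
(** A fixed point stands for a missing parent. With the same convention for [mate], a matching is an
    involution. *)
Definition parent v := nth v (ports v) (pport v).
Definition parent_same v := (pport v < deg v) && (lev (parent v) == lev v).
Definition top v := foldr maxn (lev v) [seq lev u | u <- ports v].

Lemma run1 v :
  st 1 v = Node 1 (id v) (deg v) (pport v) (parent_same v) (top v) (id v) (deg v).
Proof.
rewrite /run /= /round /= /node_recv /= -!map_comp.
rewrite [map _ _](_ : _ = [seq lev u | u <- ports v]) //; last first.
  by apply: eq_map => u /=; rewrite /message /= binaryK.
rewrite find_map -/(lev v) -/(top v) -/(deg v).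
have -> : find (preim lev (leq^~ (lev v))) (ports v) = pport v by [].
rewrite /parent_same; have [lt_p|le_p] := ltnP (pport v) (deg v).
  by rewrite (nth_map v).
by rewrite nth_default ?size_map // gtn_eqF.
Qed.

Definition stop v := (last_round (top v)).+1.

Lemma run_eta t v : 0 < t ->
  st t v = Node (minn t (stop v)) (id v) (deg v) (pport v) (parent_same v) (top v)
    (color (st t v)) (mate_port (st t v)).
Proof.
case: t => // t _; elim: t => [|t IHt].
  by rewrite run1 /stop /last_round; case: (top v).
rewrite /run iterS -/(run _ _ _ _) /round {}IHt /= /node_out /=.
have [lt_t|le_t] := ltnP t.+1 (stop v).
  rewrite -ltnS -/(stop v) lt_t /= /node_recv /=.
  by congr Node; rewrite ?(minn_idPl _) //; lia.
by rewrite -ltnS -/(stop v) ltnn (minn_idPr _) // ltnW.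
Qed.

Lemma run_out t v : 0 < t -> out (st t v) =
  if t < stop v then None else Some (fun i => i == mate_port (st t v)).
Proof.
move=> t_gt0; rewrite (run_eta v t_gt0) /= /node_out /= -ltnS -/(stop v).
by rewrite gtn_min ltnn orbF.
Qed.

Definition col t v := color (st t v).
Definition mate t v := nth v (ports v) (mate_port (st t v)).
Definition proposes t v := (t == propose_time (lev v) (col t v)) && (mate t v == v).
Definition offers t u v := (mate t u == v) || proposes t u && (parent u == v).

Lemma ports_adj u v : (u \in ports v) = G v u.
Proof. exact: (portsP v).2. Qed.

Lemma ports_sym u v : (u \in ports v) = (v \in ports u).
Proof. by rewrite !ports_adj adj_sym. Qed.

Lemma ports_neq u v : u \in ports v -> u != v.
Proof. by rewrite ports_adj; apply: contraTneq => ->; rewrite adj_irrefl. Qed.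

Lemma nth_ports_eq v i : (nth v (ports v) i == v) = (deg v <= i).
Proof.
have [le_i|lt_i] := leqP (deg v) i; first by rewrite nth_default ?eqxx.
by rewrite (negPf (ports_neq (mem_nth v lt_i))).
Qed.

Lemma nth_ports_index u v i : v \in ports u ->
  (i == index v (ports u)) = (nth u (ports u) i == v).
Proof.
move=> v_u; apply/eqP/eqP => [->|eq_v]; first exact: nth_index.
rewrite -eq_v index_uniq ?(portsP u).1 //; rewrite ltnNge -nth_ports_eq eq_v.
exact: ports_neq.
Qed.

Lemma run_message t u v : 0 < t -> v \in ports u ->
  message ports (st t) u v =
    if t < stop u then offers t u v :: binary (col t u) (col t u) else [::].
Proof.
move=> t_gt0 v_u; rewrite /message run_out //; case: ltnP => //= lt_t.
rewrite /node_send /offers /proposes /mate /col nth_ports_eq /parent -!nth_ports_index //.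
by rewrite (run_eta u t_gt0) /= (minn_idPl (ltnW lt_t)).
Qed.

Lemma lev_top v : lev v <= top v.
Proof. by rewrite /top; elim: map => //= x s; rewrite leq_max orbC => ->. Qed.

Lemma lev_top_port u v : u \in ports v -> lev u <= top v.
Proof.
rewrite /top; elim: (ports v) => //= w s IHs; rewrite inE leq_max.
by case/predU1P => [->|/IHs->]; rewrite ?leqnn ?orbT.
Qed.

Lemma lev_lt_stop v t : t <= last_round (lev v) -> t < stop v.
Proof. by rewrite /stop /last_round; have := lev_top v; lia. Qed.

Lemma lev_lt_stop_port u v t :
  u \in ports v -> t <= last_round (lev u) -> t < stop v.
Proof. by move=> /lev_top_port; rewrite /stop /last_round; lia. Qed.

Lemma parent_neq v : (parent v != v) = (pport v < deg v).
Proof. by rewrite nth_ports_eq -ltnNge. Qed.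

Lemma parent_in_ports v : parent v != v -> parent v \in ports v.
Proof. by rewrite parent_neq => /mem_nth ->. Qed.

Lemma parent_exists u v : u \in ports v -> lev u <= lev v -> parent v != v.
Proof. by move=> u_v le_uv; rewrite parent_neq -has_find; apply/hasP; exists u. Qed.

Lemma parent_sameE v : parent_same v = (parent v != v) && (lev (parent v) == lev v).
Proof. by rewrite parent_neq. Qed.

Lemma runS t v : 0 < t -> st t.+1 v =
  if t < stop v then
    recv (st t v : state matching_algorithm) [seq message ports (st t) u v | u <- ports v]
  else st t v.
Proof.
by move=> t_gt0; rewrite /run iterS -/(run _ _ _ _) /round run_out //; case: ifP.
Qed.

Lemma col1 v : col 1 v = id v.
Proof. by rewrite /col run1. Qed.

Lemma colS t v : 0 < t -> col t.+1 v =
  if t <= lev v then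
    if parent_same v then
      cole_vishkin (col t v + col t (parent v)) (col t v) (col t (parent v))
    else odd (col t v)
  else col t v.
Proof.
move=> t_gt0; rewrite {1}/col runS //; case: ifP => [lt_t|/negbT le_t]; last first.
  rewrite ifN // -ltnNge; apply: contraNltn le_t => le_t.
  by apply: lev_lt_stop; rewrite /last_round; lia.
rewrite /= /node_recv (run_eta v t_gt0) /= (minn_idPl (ltnW lt_t)) gtn_eqF //=.
rewrite -/(lev v); case: ifP => // le_t; case: ifP => // /andP[lt_p /eqP eq_l].
rewrite (nth_map [::]) ?size_map // (nth_map v) // -/(parent v).
have p_v : parent v \in ports v by apply: mem_nth.
(* Being on the same level, the parent is still running; its silence would be read as colour 0. *)
rewrite run_message 1?ports_sym // lev_lt_stop ?eq_l /=; last first.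
  by rewrite /last_round; lia.
by rewrite binaryK.
Qed.

Lemma mate1 v : mate 1 v = v.
Proof. by rewrite /mate run1 nth_default. Qed.

Lemma mateS t v : 0 < t -> mate t.+1 v =
  if (t < stop v) && (mate t v == v) then
    nth v (ports v) (find (fun u => (t < stop u) && offers t u v) (ports v))
  else mate t v.
Proof.
move=> t_gt0; rewrite {1}/mate runS //; case: ifP => //= lt_t.
rewrite /mate nth_ports_eq (run_eta v t_gt0) /= /node_recv /=.
rewrite (minn_idPl (ltnW lt_t)) gtn_eqF //= ltnNge; case: (deg v <= _) => //=.
congr nth; rewrite find_map; apply: eq_in_find => u u_v /=.
by rewrite run_message 1?ports_sym //; case: ifP.
Qed.

Lemma mate_neq_port t v : mate t v != v -> mate t v \in ports v.
Proof. by rewrite nth_ports_eq -ltnNge => /mem_nth->. Qed.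

Lemma mate_step t v : 0 < t -> mate t v != v -> mate t.+1 v = mate t v.
Proof. by move=> t_gt0 /negPf mt; rewrite mateS // mt andbF. Qed.

Lemma mate_stable t t' v : 0 < t <= t' -> mate t v != v -> mate t' v = mate t v.
Proof.
case/andP=> t_gt0 /subnK <- mt; elim: (t' - t) => // k IHk.
by rewrite addSn mate_step ?IHk ?addn_gt0 ?t_gt0 ?orbT.
Qed.

Lemma mate_new t u v : 0 < t -> mate t v = v -> mate t.+1 v = u -> u != v ->
  [/\ u \in ports v, t < stop u & offers t u v].
Proof.
move=> t_gt0 mtv; rewrite mateS // mtv eqxx andbT.
case: ifP => [lt_t|_ <-]; last by rewrite eqxx.
move=> eq_u neq_uv; move: (neq_uv).
rewrite -[in u != v]eq_u nth_ports_eq -ltnNge => lt_f.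
rewrite -eq_u mem_nth //; move: lt_f; rewrite -has_find => has_f.
by have /andP[] := nth_find v has_f.
Qed.

Lemma mate_some t u v : 0 < t -> t < stop v -> u \in ports v -> t < stop u ->
  offers t u v -> mate t.+1 v != v.
Proof.
move=> t_gt0 lt_t u_v lt_u off; rewrite mateS // lt_t /=.
case: ifP => [_|/negbT//]; rewrite nth_ports_eq -ltnNge -has_find.
by apply/hasP; exists u; rewrite ?lt_u.
Qed.

(** Identifiers are distinct, and nodes of one level take their steps in the same rounds. A step
    keeps the colours apart whether or not the parent has a parent on that level. *)
Lemma col_neq t v : 0 < t -> parent_same v -> col t v != col t (parent v).
Proof.
case: t => // t _; elim: t v => [|t IHt] v same_v.
  rewrite !col1 (inj_eq id_inj) eq_sym.
  by move: same_v; rewrite parent_sameE => /andP[].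
move: (same_v); rewrite parent_sameE => /andP[_ /eqP eq_l].
rewrite (@colS t.+1 v) // (@colS t.+1 (parent v)) // eq_l same_v.
case: ifP => _; last exact: IHt.
have lt_col u : col t.+1 u < 2 ^ col t.+1 u by exact: ltn_expl.
have lt_addl u w : col t.+1 u < 2 ^ (col t.+1 u + col t.+1 w).
  by apply: leq_trans (lt_col u) _; rewrite leq_exp2l // leq_addr.
have lt_addr u w : col t.+1 u < 2 ^ (col t.+1 w + col t.+1 u) by rewrite addnC.
case: ifP => [same_p|_]; last exact: cole_vishkin_neq_odd (IHt _ same_v).
by apply: cole_vishkin_neq => //; apply: IHt.
Qed.

(** Round 0 only exchanges identifiers, hence [t.-1]; each later step lowers the index of
    [color_bound] by one. *)
Lemma col_lt t v : 0 < t -> col t v < color_bound (lev v - t.-1).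
Proof.
case: t => // t _; elim: t v => [|t IHt] v.
  by rewrite subn0 col1 ltn_color_bound_level.
rewrite colS //=; case: (ltnP t (lev v)) => [lt_t|le_t]; last first.
  by have <- : lev v - t = lev v - t.+1 by lia.
have eq_t : lev v - t = (lev v - t.+1).+1 by lia.
have ge6 := color_bound_ge (lev v - t.+1).
case: ifP => [same_v|_]; last by lia.
move: (same_v); rewrite parent_sameE => /andP[_ /eqP eq_l].
have := @cole_vishkin_lt (col t.+1 v + col t.+1 (parent v)) _ _
  (color_bound (lev v - t.+1))./2 _ _ (col_neq _ same_v).
have := IHt v; have := IHt (parent v); rewrite /= eq_l eq_t /= => lt1 lt2.
by move=> /(_ t.+1 lt2 lt1 isT); lia.
Qed.

Lemma col_lt6 t v : lev v < t -> col t v < 6.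
Proof.
move=> lt_t; have := @col_lt t v; rewrite (eqP (_ : lev v - t.-1 == 0)); last by lia.
by apply; lia.
Qed.

Lemma col_final t v : lev v < t -> col t v = col (lev v).+1 v.
Proof.
move=> /subnK <-; elim: (t - _) => // k IHk.
by rewrite addSn colS ?IHk ?ifN //; lia.
Qed.

Lemma col_lt_exp K t v : 0 < K -> (forall u, id u < 2 ^ K) -> 0 < t -> col t v < 2 ^ K.
Proof.
move=> K_gt0 lt_id; case: t => // t _; elim: t v => [|t IHt] v; first by rewrite col1.
have le_exp : K.*2 <= 2 ^ K.
  by case: K K_gt0 {lt_id IHt} => // K _; rewrite -mul2n expnS leq_pmul2l // ltn_expl.
rewrite colS //; case: ifP => // _; case: ifP => [same_v|_]; last by lia.
by apply: leq_trans le_exp; apply: cole_vishkin_lt => //; apply: col_neq.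
Qed.

Lemma propose_lev t v : 0 < t -> proposes t v -> lev v < t.
Proof. by move=> _ /andP[/eqP ->]; rewrite /propose_time; lia. Qed.

Lemma proposes_odd t v : proposes t v -> odd t.
Proof. by case/andP=> /eqP ->; rewrite /propose_time; lia. Qed.

Lemma proposes_stop t u v : proposes t v -> u \in ports v ->
  t.+1 < stop v /\ t.+1 < stop u.
Proof.
move=> prop_t u_v; have le_t : t.+1 <= last_round (lev v).
  case/andP: (prop_t) => /eqP eq_t _.
  have := @col_lt6 t v; rewrite {1 3}eq_t /last_round /propose_time.
  by move=> lt6; have := lt6 _; lia.
by split; [exact: lev_lt_stop | apply: lev_lt_stop_port le_t; rewrite -ports_sym].
Qed.

(** Colours below 6 keep the blocks of different levels disjoint, so a common proposal time would
    mean equal level and equal colour. *)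
Lemma parent_not_proposes t v : parent v != v -> proposes t v ->
  ~~ proposes t (parent v).
Proof.
move=> p_v prop_v; apply/negP => prop_p.
have t_gt0 : 0 < t by apply/odd_gt0/proposes_odd/prop_v.
have c_v := col_lt6 (propose_lev t_gt0 prop_v).
have c_p := col_lt6 (propose_lev t_gt0 prop_p).
case/andP: prop_v prop_p => /eqP eq_v _ /andP[/eqP eq_p _].
move: eq_v eq_p; rewrite /propose_time => eq_v eq_p.
have eq_l : lev (parent v) = lev v by lia.
by have := @col_neq t v t_gt0; rewrite parent_sameE p_v eq_l eqxx => /(_ isT)/eqP[]; lia.
Qed.

(* A proposal made in an odd round is accepted in that round by the proposed
   node and acknowledged in the next one. *)
Lemma mateK_step t : odd t -> involutive (mate t) -> involutive (mate t.+2).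
Proof.
move=> t_odd mate_tK v; have t_gt0 := odd_gt0 t_odd.
have offers_even u w : offers t.+1 u w -> mate t.+1 u = w.
  by case/orP=> [/eqP //|/andP[/proposes_odd]]; rewrite oddS t_odd.
have new_proposer u w : mate t w = w -> mate t.+1 w = u -> u != w ->
    proposes t u /\ parent u = w.
  move=> mw mu neq_uw.
  have [_ _ /orP[/eqP eq_u|/andP[? /eqP]//]] := mate_new t_gt0 mw mu neq_uw.
  by move: neq_uw; rewrite -(mate_tK u) eq_u mw eqxx.
have [mv|mv] := eqVneq (mate t v) v; last first.
  have stable u : mate t u != u -> mate t.+2 u = mate t u.
    by apply: mate_stable; lia.
  by rewrite (stable v) // stable ?mate_tK // eq_sym.
have [mv1|mv1] := eqVneq (mate t.+1 v) v; last first.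
  set u := mate t.+1 v in mv1; have eq_u : mate t.+1 v = u by [].
  have [u_v _ _] := mate_new t_gt0 mv eq_u mv1.
  have [prop_u par_u] := new_proposer _ _ mv eq_u mv1.
  have mu : mate t u = u by case/andP: prop_u => _ /eqP.
  have v_u : v \in ports u by rewrite ports_sym.
  have [stop_u stop_v] := proposes_stop prop_u v_u.
  (* A proposer accepts nothing in the same round: the accepted node would be its child, proposing
     simultaneously. *)
  have mu1 : mate t.+1 u = u.
    apply: contraTeq prop_u => neq_u.
    have [prop_w par_w] := new_proposer _ _ mu erefl neq_u.
    by rewrite -[X in proposes t X]par_w parent_not_proposes // par_w eq_sym.
  have := mate_some (ltn0Sn _) stop_u v_u stop_v.
  rewrite /offers eq_u eqxx => /(_ isT) mu2.
  have [_ _ /offers_even mw] := mate_new (ltn0Sn _) mu1 erefl mu2.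
  set w := mate t.+2 u in mu2 mw.
  (* [u] was free, so [w] accepted it only now; as [u] proposed to [v] alone, [w] is [v]. *)
  have mtw : mate t w = w.
    apply: contraNeq mu2 => neq_w.
    have eq_wu : mate t w = u by rewrite -mw mate_step.
    by rewrite -[X in X == _](mate_tK w) eq_wu mu.
  have [|_] := new_proposer _ _ mtw mw; first by rewrite eq_sym.
  rewrite par_u => eq_vw.
  by rewrite (_ : mate t.+2 v = u) -/w ?eq_vw // -eq_vw mate_step.
have [eq_v|mv2] := eqVneq (mate t.+2 v) v; first by rewrite !eq_v.
have [_ _ /offers_even mw] := mate_new (ltn0Sn _) mv1 erefl mv2.
by rewrite (@mate_step t.+1 (mate t.+2 v)) ?mw // eq_sym.
Qed.

Lemma mateK t : odd t -> involutive (mate t).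
Proof.
move=> t_odd; rewrite -(odd_double_half t) t_odd add1n.
elim: t./2 => [|m IHm]; first by move=> v; rewrite !mate1.
by rewrite doubleS; apply: mateK_step; rewrite //= odd_double.
Qed.

(** When its turn comes, [v] is matched or proposes; in the latter case its parent is already
    matched or accepts some offer, possibly another one. *)
Lemma parent_covered t v : stop v <= t -> parent v != v ->
  (mate t v != v) || (mate t (parent v) != parent v).
Proof.
move=> le_t p_v; set u := parent v.
pose s := propose_time (lev v) (col (lev v).+1 v).
have lt_s : lev v < s by rewrite /s /propose_time; lia.
have s_gt0 : 0 < s by apply: leq_trans lt_s.
have u_v : u \in ports v by apply: parent_in_ports.
have prop_s : mate s v = v -> proposes s v.
  by move=> ms; rewrite /proposes ms (col_final lt_s) !eqxx.
have le_st : s < t.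
  apply: leq_trans le_t; apply: lev_lt_stop.
  by have := @col_lt6 _ v (ltnSn _); rewrite /s /propose_time /last_round; lia.
have stable s' w : 0 < s' <= t -> mate s' w != w -> mate t w != w.
  by move=> le_s ms; rewrite (mate_stable le_s).
have [ms|ms] := eqVneq (mate s v) v; last by rewrite (stable s) // s_gt0 ltnW.
rewrite (stable s.+1 u) ?orbT //.
have [mu|mu] := eqVneq (mate s u) u; last by rewrite mate_step.
have [stop_v stop_u] := proposes_stop (prop_s ms) u_v.
apply: (@mate_some _ v) => //; rewrite ?(ltnW stop_u) ?(ltnW stop_v) //.
- by rewrite ports_sym.
- by rewrite /offers (prop_s ms) eqxx orbT.
Qed.

Lemma dist_le_meet e f x : e \in edges G -> f \in edges G -> x \in e -> x \in f ->
  dist_le (line_adj G) e f 1.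
Proof.
move=> Ge Gf ex fx; have [<-|neq_ef] := eqVneq e f; first by exists 0 => //; exists [::].
exists 1 => //; exists [:: f]; split=> //=; rewrite andbT; apply/and4P; split=> //.
by apply/set0Pn; exists x; rewrite inE ex.
Qed.

Lemma port_edge u v : u \in ports v -> [set v; u] \in edges G.
Proof.
rewrite ports_adj => Gvu; rewrite inE; apply/existsP; exists v.
by apply/existsP; exists u; rewrite Gvu eqxx.
Qed.

Definition mate_edges t := [set [set v; mate t v] | v : 'I_n & mate t v != v].

Lemma mem_mate_edges t v : mate t v != v -> [set v; mate t v] \in mate_edges t.
Proof. by move=> mv; apply/imsetP; exists v; rewrite ?inE. Qed.

Lemma mate_edges_incident t e x : odd t -> e \in mate_edges t -> x \in e ->
  e = [set x; mate t x].
Proof.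
move=> t_odd /imsetP[v _ ->]; rewrite !inE => /orP[]/eqP -> //.
by rewrite mateK // setUC.
Qed.

Lemma mate_edges_sub t : mate_edges t \subset edges G.
Proof.
apply/subsetP => e /imsetP[v]; rewrite inE => mv ->.
exact/port_edge/mate_neq_port.
Qed.

Lemma mate_edges_ruling t : odd t -> (forall v, stop v <= t) ->
  ruling_edge_set G 2 2 (mate_edges t).
Proof.
move=> t_odd le_t; split; first exact: mate_edges_sub.
  move=> e f Re Rf /eqP neq_ef [|[|//]] [p [path_p last_p sz_p]].
    by case: p sz_p path_p last_p.
  case: p sz_p path_p last_p => [|g [|]] //= _.
  rewrite andbT => /and4P[_ _ _ /set0Pn[x]] + eq_g; rewrite eq_g inE => /andP[ex fx].
  by case: neq_ef; rewrite (mate_edges_incident t_odd Re ex)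
    -(mate_edges_incident t_odd Rf fx).
suff covered u v : u \in ports v -> lev u <= lev v ->
    exists2 f, f \in mate_edges t & dist_le (line_adj G) [set v; u] f 2.
  move=> e; rewrite inE => /existsP[u /existsP[v /andP[Guv /eqP ->]]].
  have [le_uv|/ltnW le_vu] := leqP (lev u) (lev v).
    by rewrite setUC; apply: covered; rewrite // ports_adj adj_sym.
  by apply: covered; rewrite // ports_adj.
move=> u_v /(parent_exists u_v) p_v.
have Gvu := port_edge u_v; have Gvp := port_edge (parent_in_ports p_v).
(* The edge to the parent is the intermediate stop: it meets the given edge at [v] and a matching
   edge at whichever end is covered. *)
have dist_vp : dist_le (line_adj G) [set v; u] [set v; parent v] 1.
  by apply: (@dist_le_meet _ _ v); rewrite // !inE eqxx.
have [w [w_vp mw]] : exists w, w \in [set v; parent v] /\ mate t w != w.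
  by have /orP[mw|mw] := parent_covered (le_t v) p_v; [exists v | exists (parent v)];
     rewrite !inE eqxx ?orbT.
exists [set w; mate t w]; first exact: mem_mate_edges.
apply: (dist_le_trans dist_vp); apply: (@dist_le_meet _ _ w) => //.
  exact/port_edge/mate_neq_port.
by rewrite !inE eqxx.
Qed.

Lemma mate_edges_output t : odd t -> (forall v, stop v <= t) ->
  outputs_edge_set matching_algorithm id ports t (mate_edges t).
Proof.
move=> t_odd le_t v; exists (fun i => i == mate_port (st t v)).
  by rewrite run_out ?odd_gt0 // ltnNge le_t.
move=> u u_v; rewrite eq_sym nth_ports_index // -/(mate t v).
have neq_uv := ports_neq u_v; apply/eqP/idP => [mv|Rvu].
  by rewrite -{1}mv; apply: mem_mate_edges; rewrite mv.
have := mate_edges_incident t_odd Rvu (set21 v u).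
by move/setP/(_ u); rewrite !inE eqxx orbT (negPf neq_uv) => /esym/eqP.
Qed.

Lemma message_size K t u v : 0 < K -> (forall w, id w < 2 ^ K) -> G u v ->
  size (message ports (st t) u v) <= K.+1.
Proof.
move=> K_gt0 lt_id Guv; case: t => [|t].
  by rewrite /message /= ltnS size_binary.
rewrite run_message ?ports_adj //; case: ifP => //= _.
by rewrite ltnS size_binary // col_lt_exp.
Qed.

End MatchingRun.

(** * Levels and the iterated logarithm *)

Lemma color_bound_logstar A C j n : 4 <= A -> A.*2 <= color_bound C ->
  logstar n <= j -> A.*2 * n <= color_bound (C + j).
Proof.
move=> A_ge4 le_C; elim: j n => [|j IHj] n le_j.
  rewrite addn0; apply: leq_trans le_C; move: le_j; rewrite logstar_le /= => le_n1.
  by rewrite -[leqRHS]muln1 leq_mul2l le_n1 orbT.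
have [le_n1|lt_1n] := leqP n 1.
  apply: leq_trans (leq_trans le_C (leq_color_bound (leq_addr _ _))).
  by rewrite -[leqRHS]muln1 leq_mul2l le_n1 orbT.
have m_gt0 : 0 < up_log 2 n by rewrite up_log_gt0.
rewrite addnS /=; move: le_j; rewrite logstar_up_log => /IHj le_m.
(* The halved exponent is at least [A * up_log 2 n], hence at least [A.-1 + up_log 2 n]; its first
   part restores the factor [A.*2], which is where [4 <= A] enters. *)
have exp_A : A.*2 <= 2 ^ A.-1.
  elim: A A_ge4 {le_C IHj le_m} => // -[|[|[|[|A]]]] // IHA _.
  by have := IHA isT; rewrite /= (expnS 2 A.+3); lia.
apply: (@leq_trans (2 ^ (A * up_log 2 n))); last first.
  by rewrite leq_exp2l //; move: le_m; set x := color_bound _; nia.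
have le_nm := up_logP n (isT : 1 < 2).
apply: leq_trans (leq_mul exp_A le_nm) _; rewrite -expnD leq_exp2l //; nia.
Qed.

Lemma level_logstar a : exists C, forall n x, x < 2 ^ (a * up_log 2 n) ->
  level x <= C + logstar n.
Proof.
pose A := a + 4; exists A.*2 => n x lt_x; apply: level_le; apply: leq_trans lt_x _.
have [le_n1|lt_1n] := leqP n 1.
  rewrite [up_log 2 n](_ : _ = 0) ?muln0.
    by have := color_bound_ge (A.*2 + logstar n); lia.
  by case: n le_n1 => [|[]].
have := leqnn (logstar n); case: {2 3}(logstar n) => [|j].
  by rewrite logstar_le leqNgt lt_1n.
rewrite logstar_up_log addnS /= leq_exp2l // => le_m.
have le_C : A.*2 <= color_bound A.*2 by have := color_bound_ge A.*2; lia.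
have := color_bound_logstar (leq_addl a 4) le_C le_m.
by rewrite /A; set y := color_bound _; nia.
Qed.

Lemma ruling_edge_set_upper_bound a : 0 < a ->
  exists b (A : algorithm) (T : nat -> nat),
    (forall n, computes_ruling_edge_set 2 a b A n (T n)) /\ bigO T logstar.
Proof.
move=> a_gt0; have [C level_le_C] := level_logstar a.
pose T n := (last_round (C + logstar n)).+1.
(* The extra unit in [a.+1] pays for the flag bit. [T n] is odd, as [mateK] requires. *)
exists a.+1, matching_algorithm, T; split; last first.
  exists (12 * (C + 2) + 13), 2 => n le_2n.
  have ls_gt0 : 0 < logstar n by rewrite ltnNge logstar_le -ltnNge.
  by rewrite /T /last_round; nia.
move=> n G id ports [id_inj lt_id] portsP; split.
  move=> i u v Guv; have n_gt1 : 1 < n.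
    have : u != v by apply: contraTneq Guv => ->; rewrite adj_irrefl.
    by rewrite -val_eqE /=; have := ltn_ord u; have := ltn_ord v; lia.
  have m_gt0 : 0 < up_log 2 n by rewrite up_log_gt0.
  have K_gt0 : 0 < a * up_log 2 n by rewrite muln_gt0 a_gt0.
  apply: leq_trans (message_size id_inj portsP _ K_gt0 lt_id Guv) _.
  by rewrite mulSn addnC -addn1 leq_add2l.
have T_odd : odd (T n) by rewrite /T /last_round; lia.
have stop_le v : stop id ports v <= T n.
  have : top id ports v <= C + logstar n.
    rewrite /top; elim: (ports v) => [|u s IHs] /=; first exact/level_le_C.
    by rewrite geq_max IHs level_le_C.
  by rewrite /stop /T /last_round; lia.
exists (mate_edges id ports (T n)).
  exact: mate_edges_ruling.
exact: mate_edges_output.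
Qed.

(* Upper bound: one algorithm, independent of n, for all graphs.
   Lower bound: it even holds for algorithms tailored to n. *)
Theorem theorem3 (a : nat) (ha : 0 < a) :
  (exists (b : nat) (A : algorithm) (T : nat -> nat),
     (forall n : nat, computes_ruling_edge_set 2 a b A n (T n)) /\
     bigO T logstar) /\
  (forall (b : nat) (A : nat -> algorithm) (T : nat -> nat),
     (forall n : nat, computes_ruling_edge_set 2 a b (A n) n (T n)) ->
     bigO logstar T).
Proof.
split; first exact: ruling_edge_set_upper_bound.
by move=> b A T; apply: ruling_edge_set_lower_bound.
Qed.
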